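(* Let $G$ be a locally compact (Hausdorff) abelian topological group, regarded as an hls-space with its topology and its group ls-structure. Then the following conditions are equivalent: (1) $G$ is hls-normal; (2) $G$ is $\sigma$-compact; (3) the ls-structure on $G$ is metrizable, that is, induced by a metric.
   Context: For $B\subseteq X$ and a family $\mathcal{U}$ of subsets of $X$, $\mathrm{st}(B,\mathcal{U})$ is the union of the elements of $\mathcal{U}$ meeting $B$; for a family $\mathcal{B}$, $\mathrm{st}(\mathcal{B},\mathcal{U})=\{\mathrm{st}(B,\mathcal{U})\mid B\in\mathcal{B}\}$. A large scale structure (ls-structure) on a set $X$ is a nonempty collection $\mathcal{L}$ of families of subsets of $X$ (the uniformly bounded families) such that: (i) if $\mathcal{B}_1\in\mathcal{L}$ and each element of $\mathcal{B}_2$ having more than one point is contained in some element of $\mathcal{B}_1$, then $\mathcal{B}_2\in\mathcal{L}$; (ii) $\mathcal{B}_1,\mathcal{B}_2\in\mathcal{L}$ implies $\mathrm{st}(\mathcal{B}_1,\mathcal{B}_2)\in\mathcal{L}$. A hybrid large scale space (hls-space) is a set with an ls-structure and a topology such that some uniformly bounded cover consists of open sets. The ls-structure induced by a metric $d$ on $X$ consists of all families of subsets which refine $\{B(x,R)\mid x\in X\}$ for some $R>0$. The group ls-structure on a locally compact group $G$ consists of all families of subsets of $G$ which refine $\{g\cdot K\mid g\in G\}$ for some compact set $K\subseteq G$; together with the topology of $G$ it makes $G$ an hls-space. A subset is bounded if it is an element of some uniformly bounded cover. The coarse component of a point $x$ is the union of all bounded sets containing $x$. A subset is weakly bounded if its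 intersection with every coarse component is bounded. $N$ is a coarse neighbourhood of $A$ if $A\subseteq N$ and for every uniformly bounded cover $\mathcal{U}$, $\mathrm{st}(A,\mathcal{U})\subseteq N\cup K$ for some weakly bounded $K$. $N$ is a topological neighbourhood of $A$ if $N$ contains an open set containing $\mathrm{cl}(A)$. $N$ is a hybrid neighbourhood of $A$ if it is both a topological and a coarse neighbourhood of $A$. An hls-space $X$ is hls-normal if for every closed $A\subseteq X$ and every hybrid neighbourhood $N$ of $A$ there is a closed $V\subseteq X$ such that $V$ is a hybrid neighbourhood of $A$ and $N$ is a hybrid neighbourhood of $V$. *)

(* Defs.v *)
From HB Require Import structures.
From mathcomp Require Import all_boot all_order all_algebra.
From mathcomp Require Import all_classical all_reals all_analysis.

Set Implicit Arguments.
Unset Strict Implicit.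
Unset Printing Implicit Defensive.

Import Order.TTheory GRing.Theory Num.Theory.

Local Open Scope classical_set_scope.
Local Open Scope ring_scope.

Definition star (X : Type) (B : set X) (U : set (set X)) : set X :=
  \bigcup_(V in [set V | U V /\ V `&` B !=set0]) V.

Definition star_family (X : Type) (B U : set (set X)) : set (set X) :=
  [set star A U | A in B].

Definition is_cover (X : Type) (U : set (set X)) : Prop :=
  \bigcup_(V in U) V = [set: X].

Definition refines (X : Type) (B C : set (set X)) : Prop :=
  forall A, B A -> exists2 D, C D & A `<=` D.

Record lsStructure (X : Type) := LsStructure {
  unif_bounded : set (set (set X));
  unif_bounded_nonempty : unif_bounded !=set0;
  unif_bounded_coarsen : forall B1 B2 : set (set X),
    unif_bounded B1 ->
    (forall A, B2 A -> (exists x y, [/\ A x, A y & x <> y]) ->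
       exists2 D, B1 D & A `<=` D) ->
    unif_bounded B2;
  unif_bounded_star : forall B1 B2 : set (set X),
    unif_bounded B1 -> unif_bounded B2 -> unif_bounded (star_family B1 B2) }.

Record hlsStructure (X : topologicalType) := HlsStructure {
  hls_ls :> lsStructure X;
  hls_open_cover : exists U : set (set X),
    [/\ unif_bounded hls_ls U, is_cover U & forall V, U V -> open V] }.

Section coarse.
Variables (X : Type) (L : lsStructure X).

Definition ls_bounded (B : set X) : Prop :=
  exists U, [/\ unif_bounded L U, is_cover U & U B].

Definition coarse_component (x : X) : set X :=
  \bigcup_(B in [set B | ls_bounded B /\ B x]) B.

Definition weakly_bounded (B : set X) : Prop :=
  forall x, ls_bounded (B `&` coarse_component x).

Definition coarse_neighbourhood (A N : set X) : Prop :=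
  A `<=` N /\
  forall U, unif_bounded L U -> is_cover U ->
    exists2 K, weakly_bounded K & star A U `<=` N `|` K.

(* d is only a distance on the underlying set; it need not be compatible with
   any topology carried by X. *)
Definition ls_metric_induced (R : realType) (d : X -> X -> R) : Prop :=
  forall B, unif_bounded L B <->
    exists2 r : R, 0 < r & refines B [set [set y | d x y < r] | x in [set: X]].

End coarse.

Definition is_metric (R : realType) (X : Type) (d : X -> X -> R) : Prop :=
  [/\ forall x y, 0 <= d x y,
      forall x y, d x y = 0 <-> x = y,
      forall x y, d x y = d y x &
      forall x y z, d x z <= d x y + d y z].

Definition ls_metrizable (R : realType) (X : Type) (L : lsStructure X) : Prop :=
  exists2 d : X -> X -> R, is_metric d & ls_metric_induced L d.

Definition topological_neighbourhood (X : topologicalType) (A N : set X) : Prop :=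
  exists2 O : set X, open O & closure A `<=` O /\ O `<=` N.

Definition hybrid_neighbourhood (X : topologicalType) (L : hlsStructure X)
    (A N : set X) : Prop :=
  topological_neighbourhood A N /\ coarse_neighbourhood L A N.

Definition hls_normal (X : topologicalType) (L : hlsStructure X) : Prop :=
  forall A N : set X, closed A -> hybrid_neighbourhood L A N ->
    exists V : set X,
      [/\ closed V, hybrid_neighbourhood L A V & hybrid_neighbourhood L V N].

Definition sigma_compact (X : topologicalType) : Prop :=
  exists K : nat -> set X,
    (forall n, compact (K n)) /\ \bigcup_n K n = [set: X].

Section group_structure.
Variable G : topologicalZmodType.

(* The group law is written additively: these are the sets g . K. *)
Definition translates (K : set G) : set (set G) :=
  [set [set g + k | k in K] | g in [set: G]].

Definition group_unif_bounded : set (set (set G)) :=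
  [set B | exists2 K : set G, compact K & refines B (translates K)].

Lemma compact_add (A B : set G) : compact A -> compact B ->
  compact [set p.1 + p.2 | p in A `*` B].
Proof.
move=> cA cB; apply: continuous_compact; last exact: compact_setX.
exact/continuous_subspaceT/add_continuous.
Qed.

Lemma compact_opp (A : set G) : compact A -> compact [set - a | a in A].
Proof.
move=> cA; apply: continuous_compact => //.
exact/continuous_subspaceT/opp_continuous.
Qed.

Lemma group_unif_bounded_nonempty : group_unif_bounded !=set0.
Proof. by exists set0, set0 => //; exact: compact0. Qed.

Lemma group_unif_bounded_coarsen (B1 B2 : set (set G)) :
  group_unif_bounded B1 ->
  (forall A, B2 A -> (exists x y, [/\ A x, A y & x <> y]) ->
     exists2 D, B1 D & A `<=` D) ->
  group_unif_bounded B2.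
Proof.
move=> [K cK B1K] B12; exists (K `|` [set 0]).
  by apply: compactU => //; exact: compact_set1.
move=> A B2A.
have [/(B12 _ B2A)[D /B1K[_ [g _ <-] DgK] AD]|nA] :=
    pselect (exists x y, [/\ A x, A y & x <> y]).
  exists [set g + k | k in K `|` [set 0]]; first by exists g.
  by move=> x /AD/DgK[k Kk <-]; exists k => //; left.
have [[a Aa]|A0] := pselect (A !=set0); last first.
  exists [set 0 + k | k in K `|` [set 0]]; first by exists 0.
  by move=> x Ax; case: A0; exists x.
exists [set a + k | k in K `|` [set 0]]; first by exists a.
move=> x Ax; exists 0; first by right.
rewrite addr0; apply: contrapT => ax; apply: nA.
by exists a, x.
Qed.

Lemma group_unif_bounded_star (B1 B2 : set (set G)) :
  group_unif_bounded B1 -> group_unif_bounded B2 ->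
  group_unif_bounded (star_family B1 B2).
Proof.
move=> [K1 cK1 B1K] [K2 cK2 B2K].
exists [set p.1 + p.2 | p in
    [set p.1 + p.2 | p in K1 `*` [set - k | k in K2]] `*` K2].
  by apply: compact_add => //; apply: compact_add => //; exact: compact_opp.
move=> _ [A /B1K[_ [g _ <-] AgK] <-]; eexists; first by exists g.
move=> x [V [/B2K[_ [h _ <-] VhK] [y [Vy /AgK[k1 K1k1 gy]]]] Vx].
have [k2 K2k2 hy] := VhK _ Vy; have [k3 K2k3 hx] := VhK _ Vx.
exists (k1 + - k2 + k3).
  exists (k1 + - k2, k3) => //; split => //=.
  by exists (k1, - k2) => //; split => //=; exists k2.
by rewrite -hx !addrA gy -hy addrK.
Qed.

Definition group_ls : lsStructure G :=
  LsStructure group_unif_bounded_nonempty group_unif_bounded_coarsen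
    group_unif_bounded_star.

Lemma group_open_cover : locally_compact [set: G] ->
  exists U : set (set G), [/\ unif_bounded group_ls U, is_cover U & forall V, U V -> open V].
Proof.
move=> lcG; have [K K0 [cK _]] := lcG 0 Logic.I.
exists (translates K°); split.
- exists K => // _ [g _ <-]; eexists; first by exists g.
  by apply: image_subset; exact: interior_subset.
- apply/seteqP; split=> // g _; exists [set g + k | k in K°]; first by exists g.
  exists 0; last exact: addr0.
  by apply: (@filterS _ (nbhs (0 : G)) _ _ _ _ K0) => y; exact.
- move=> _ [g _ <-].
  have -> : [set g + k | k in K°] = (fun x => x - g) @^-1` K°.
    apply/seteqP; split=> [_ [k Kk <-] /=|x /= Kx].
      by rewrite addrAC subrr add0r.
    by exists (x - g) => //; rewrite addrC subrK.
  apply: open_comp; last exact: open_interior.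
  move=> x _; apply: (@continuous_comp _ _ _ (fun x => (x, g))
    (fun x : G * G => x.1 - x.2)); last exact: sub_continuous.
  by apply: cvg_pair; [exact: cvg_id|exact: cvg_cst].
Qed.

Definition group_hls (lcG : locally_compact [set: G]) : hlsStructure G :=
  HlsStructure (group_open_cover lcG).

End group_structure.

(* Main.v *)
(* Bounded sets are the relatively compact ones, and N is a coarse neighbourhood
   of A iff A is in N and every A + C with C compact is in N up to a compact
   set.

   A sigma-compact G carries a subadditive symmetric length l : G -> nat whose
   balls exhaust the compact sets; l (y - x) is then an inducing metric, and
   conversely the balls around 0 of an inducing metric are relatively compact.

   If G is sigma-compact and N is a hybrid neighbourhood of A, then the points x
   with l x > g (l (x - a)) for some a in A, g growing fast enough, together
   with a small thickening of a bounded part of A, have as closure the required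
   intermediate set.

   If G is not sigma-compact, it has an open, sigma-compact, noncompact subgroup
   H. Let S be a transversal of the cosets other than H. The complement of H is
   a hybrid neighbourhood of S; but any V in between would, up to compact sets,
   contain S + K_n for each term of an exhaustion K_n of H, hence contain a
   whole coset s + H because there are too many cosets. Translating by - s
   makes H relatively compact. *)

Require Import Defs.
From mathcomp Require Import all_boot all_order all_algebra.
From mathcomp Require Import all_classical all_reals all_analysis.
From mathcomp Require Import zify.

Local Open Scope classical_set_scope.

Set Implicit Arguments.
Unset Strict Implicit.
Unset Printing Implicit Defensive.

Import Order.TTheory GRing.Theory Num.Theory.

Local Open Scope ring_scope.

Section topological_group.
Variable G : topologicalZmodType.
Implicit Types (A B C N O P U : set G) (x y : G).

(** * Neighbourhoods, closures and compact exhaustions *)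

Lemma cvg_addl x y : (fun z : G => x + z) @ y --> x + y.
Proof.
apply: (@continuous_comp _ _ _ (fun z => (x, z)) (fun p : G * G => p.1 + p.2)).
  by apply: cvg_pair; [exact: cvg_cst|exact: cvg_id].
exact: add_continuous.
Qed.

Lemma nbhs_addl x A : nbhs x A <-> nbhs 0 [set k | A (x + k)].
Proof.
split=> [xA|A0]; first by have := @cvg_addl x 0; rewrite addr0; exact.
have := @cvg_addl (- x) x; rewrite addNr => /(_ _ A0) xA.
by apply: (@filterS _ (nbhs x) _ _ _ _ xA) => z /=; rewrite addNKr.
Qed.

Lemma closure_sub_nbhs0 B P x : nbhs 0 P -> closure B x ->
  exists b p, [/\ B b, P p & x = b - p].
Proof.
move=> P0 /(_ [set y | P (y - x)])[|y [By Pyx]].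
  apply/nbhs_addl; apply: filterS P0 => k /=.
  by rewrite addrAC subrr add0r.
by exists y, (y - x); split=> //; rewrite opprB addrC subrK.
Qed.

(** The interiors of the sets [K n] form an increasing open cover of [C]. *)
Lemma compact_sub_bigcup (K : nat -> set G) C : compact C ->
  (forall m n, (m <= n)%N -> K m `<=` K n) ->
  (forall n x, K n x -> nbhs x (K n.+1)) ->
  C `<=` \bigcup_n K n -> exists n, C `<=` K n.
Proof.
move=> /compact_near_coveringP cC Kle nK CK.
have := cC nat \oo K; case=> [x Cx|n _ /(_ n (leqnn n)) Cn]; last by exists n.
have [m _ Kmx] := CK _ Cx.
exists (K m.+1, [set n | (m.+1 <= n)%N]) => /=; last first.
  by move=> [y n] /= [Ky /Kle]; apply.
by split; [exact: nK|exists m.+1].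
Qed.

(** * Bounded sets and coarse neighbourhoods *)

Lemma ls_boundedP B :
  ls_bounded (group_ls G) B <-> exists2 C, compact C & B `<=` C.
Proof.
split=> [[U [[K cK UK] _ /UK[_ [g _ <-] BgK]]]|[C cC BC]].
  exists [set g + k | k in K] => //; apply: continuous_compact => //.
  by apply: continuous_subspaceT => y; exact: cvg_addl.
(* Adding [0] makes the family a cover; admitting all subsets of translates makes [B] a member. *)
exists [set V | exists g, V `<=` [set g + k | k in C `|` [set 0]]]; split.
- exists (C `|` [set 0]); first by apply: compactU => //; exact: compact_set1.
  by move=> A [g Ag]; exists [set g + k | k in C `|` [set 0]] => //; exists g.
- apply/seteqP; split=> // x _; exists [set x] => //; exists x => _ ->.
  by exists 0; [right|rewrite addr0].
- by exists 0 => x /BC Cx; exists x; [left|rewrite add0r].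
Qed.

(** [G] is a single coarse component, since each [[set 0; x]] is compact. *)
Lemma weakly_boundedP B :
  weakly_bounded (group_ls G) B <-> exists2 C, compact C & B `<=` C.
Proof.
split=> [/(_ 0)/ls_boundedP[C cC BC]|[C cC BC] x].
  exists C => // x Bx; apply: BC; split=> //.
  exists [set 0; x]; last by right.
  split; last by left.
  apply/ls_boundedP; exists [set 0; x] => //.
  by apply: compactU; exact: compact_set1.
by apply/ls_boundedP; exists C => // y [/BC].
Qed.

(** The star of [A] in a family refining the translates of [K] lies in [A + (K - K)]; conversely
    [A + C] lies in the star for the translates of [C] with [0] added. *)
Lemma coarse_neighbourhoodP A N : coarse_neighbourhood (group_ls G) A N <->
  A `<=` N /\ forall C, compact C -> exists2 D, compact D &
    forall a c, A a -> C c -> N (a + c) \/ D (a + c).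
Proof.
split=> -[AN h]; split=> //.
  move=> C cC; have := h (translates (C `|` [set 0])); case.
  - exists (C `|` [set 0]); last by move=> B; exists B.
    by apply: compactU => //; exact: compact_set1.
  - apply/seteqP; split=> // x _; exists [set x + k | k in C `|` [set 0]].
      by exists x.
    by exists 0; [right|rewrite addr0].
  move=> K /weakly_boundedP[D cD KD] AUK; exists D => // a c Aa Cc.
  have /AUK[|/KD] : star A (translates (C `|` [set 0])) (a + c); [|by left|by right].
  exists [set a + k | k in C `|` [set 0]]; last by exists c => //; left.
  split; first by exists a.
  by exists a; split=> //; exists 0; [right|rewrite addr0].
move=> U [K cK UK] _; have [] := h [set p.1 + p.2 | p in K `*` [set - k | k in K]].
  by apply: compact_add => //; exact: compact_opp.
move=> D cD AD; exists D; first by apply/weakly_boundedP; exists D.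
move=> x [V [/UK[_ [g _ <-] VgK] [a [Va Aa]]] Vx].
have [k Kk gka] := VgK _ Va; have [k' Kk' gkx] := VgK _ Vx.
have -> : x = a + (k' - k) by rewrite -gkx -gka addrACA subrr addr0.
by apply: AD => //; exists (k', - k) => //; split=> //=; exists k.
Qed.

(** * Length functions *)

(** [c n] prescribes what stage [n.+1] must absorb, possibly depending on [K n]. *)
Lemma compact_chain (c : nat -> set G -> set G) : locally_compact [set: G] ->
  (forall n C, compact C -> compact (c n C)) ->
  exists K : nat -> set G,
    [/\ K 0%N = [set 0], forall n, compact (K n),
        forall n, c n (K n) `<=` K n.+1,
        forall m n, (m <= n)%N -> K m `<=` K n &
        [/\ forall n x, K n x -> nbhs x (K n.+1),
            forall n x, K n x -> K n (- x) &
            forall n x y, K n x -> K n y -> K n.+1 (x + y)]].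
Proof.
move=> lcG cc; have [V V0 [cV _]] := lcG 0 I.
have {}V0 : nbhs 0 V by apply: (@filterS _ (nbhs (0 : G)) _ _ _ _ V0) => y; exact.
(* The compact neighbourhood [V] of [0] puts [K n] inside the interior of [K n.+1]; [M']
   symmetrizes. *)
pose M n A := A `|` V `|` c n A.
pose M' n A := M n A `|` [set - x | x in M n A].
pose K := fix K n := if n is m.+1 then
  [set p.1 + p.2 | p in M' m (K m) `*` M' m (K m)] else [set 0 : G].
have KC n : compact (K n).
  elim: n => [|n IHn]; first exact: compact_set1.
  have cM : compact (M n (K n)).
    by apply: compactU; [exact: compactU|exact: cc].
  have cM' : compact (M' n (K n)) by apply: compactU => //; exact: compact_opp.
  exact: compact_add.
have M'N n A x : M' n A x -> M' n A (- x).
  by case=> [Mx|[y My <-]]; [right; exists x|left; rewrite opprK].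
have KN n x : K n x -> K n (- x).
  case: n => [/= ->|n]; first by rewrite oppr0.
  case=> -[a b] [/= /M'N Ma /M'N Mb] <-.
  by exists (- a, - b); rewrite // opprD.
have KD n x y : K n x -> K n y -> K n.+1 (x + y).
  by move=> Kx Ky; exists (x, y) => //; split; left; left; left.
have K0 n : K n 0 by elim: n => // n IHn; rewrite -[0]addr0; exact: KD.
have MK n x : M n (K n) x -> K n.+1 x.
  move=> Mx; exists (x, 0); last exact: addr0.
  by split; [left|left; left; left; exact: K0].
exists K; split=> //; last split=> //.
- by move=> n x cx; apply: MK; right.
- move=> m n; elim: n => [|n IHn]; first by rewrite leqn0 => /eqP ->.
  rewrite leq_eqVlt => /predU1P[-> //|/IHn mn] x /mn Kx.
  by rewrite -[x]addr0; exact: KD.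
- move=> n x Kx; apply/nbhs_addl; apply: filterS V0 => k Vk.
  exists (x, k) => //; split; left; left; first by left.
  by right.
Qed.


Lemma length_function : locally_compact [set: G] -> sigma_compact G ->
  exists l : G -> nat,
    [/\ forall x, l x = 0%N <-> x = 0, forall x, l (- x) = l x,
        forall x y, (l (x + y)%R <= l x + l y)%N,
        nbhs 0 [set x | (l x <= 1)%N] &
        (forall n, compact [set x | (l x <= n)%N]) /\
        forall C, compact C -> exists n, C `<=` [set x | (l x <= n)%N]].
Proof.
move=> lcG [X [cX XT]].
have [K [K0 cK XK Kle [nK KN KD]]] :=
  @compact_chain (fun n _ => X n) lcG (fun n _ _ => cX n).
have exK x : exists n, `[< K n x >].
  have [n _ Xx] : (\bigcup_n X n) x by rewrite XT.
  by exists n.+1; apply/asboolP/XK.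
pose l x := ex_minn (exK x).
have lP x n : (l x <= n)%N <-> K n x.
  rewrite /l; case: ex_minnP => m /asboolP Km mle; split=> [mn|Kn].
    exact: Kle mn _ Km.
  by apply: mle; apply/asboolP.
have lK x : K (l x) x by apply/lP.
have l0 x : l x = 0%N <-> x = 0.
  split=> [lx0|->]; first by have := lK x; rewrite lx0 K0.
  by apply/eqP; rewrite -leqn0; apply/lP; rewrite K0.
have lE n : [set x | (l x <= n)%N] = K n by apply/seteqP; split=> x /lP.
exists l; split=> //.
- by move=> x; apply/eqP; rewrite eqn_leq; apply/andP; split;
    apply/lP; [|rewrite -{2}(opprK x)]; exact/KN/lK.
(* For positive m and n, max(m, n) + 1 <= m + n, so [KD] suffices; zero lengths are treated
   apart. *)
- move=> x y; case lx: (l x) => [|m].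
    by move/l0: lx => ->; rewrite add0r.
  case ly: (l y) => [|n].
    by move/l0: ly => ->; rewrite addr0 lx addn0.
  rewrite addSn; apply/lP/KD; apply/lP; rewrite ?lx ?ly ?addnS ?ltnS.
    by rewrite leq_addr.
  by rewrite leq_addl.
- by rewrite lE; apply: nK; rewrite K0.
split=> [n|C cC]; first by rewrite lE.
have [|n Cn] := compact_sub_bigcup cC Kle nK; first by move=> x _; exists (l x).
by exists n; rewrite lE.
Qed.

(** * Metrizability *)

Lemma sigma_compact_ls_metrizable (R : realType) :
  locally_compact [set: G] -> sigma_compact G ->
  ls_metrizable R (group_ls G).
Proof.
move=> lcG /(length_function lcG)[l [l0 lN lD _ [lc lb]]].
exists (fun x y => (l (y - x))%:R).
  split=> [x y|x y|x y|x y z].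
  - exact: ler0n.
  - split=> [/eqP|->]; last by rewrite subrr; have /l0 -> := erefl (0 : G).
    by rewrite pnatr_eq0 => /eqP/l0/subr0_eq.
  - by rewrite -lN opprB.
  - by rewrite -natrD ler_nat addnC -{1}(subrK y z) -addrA.
move=> B; split=> [[C /lb[n Cn] BC]|[r r0 Br]].
  (* Balls are strict, so [l <= n] needs radius [n.+1]. *)
  exists n.+1%:R; first exact: ltr0Sn.
  move=> A /BC[_ [g _ <-] AgC]; eexists; first by exists g.
  move=> x /AgC[k Ck <-] /=; rewrite addrAC subrr add0r ltr_nat ltnS.
  exact: Cn.
exists [set x | (l x <= Num.bound r)%N]; first exact: lc.
move=> A /Br[_ [g _ <-] Ag]; eexists; first by exists g.
move=> x /Ag /= lr; exists (x - g); last by rewrite addrC subrK.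
rewrite /= -(ler_nat R); apply: ltW; apply: lt_trans lr _.
by have := archi_boundP (ltW r0).
Qed.

Lemma ls_metrizable_sigma_compact (R : realType) :
  ls_metrizable R (group_ls G) -> sigma_compact G.
Proof.
move=> [d _ dB].
have : forall n : nat, exists C, compact C /\ [set y | d 0 y < n.+1%:R] `<=` C.
  move=> n; pose U := [set [set y | d x y < n.+1%:R] | x in [set: G]].
  have [K cK UK] : unif_bounded (group_ls G) U.
    by apply/dB; exists n.+1%:R; [exact: ltr0Sn|move=> A UA; exists A].
  have [|_ [g _ <-] dg] := UK [set y | d 0 y < n.+1%:R]; first by exists 0.
  exists [set g + k | k in K]; split=> //; apply: continuous_compact => //.
  by apply: continuous_subspaceT => y; exact: cvg_addl.
move=> /choice[K KP]; exists K; split=> [n|]; first by have [] := KP n.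
apply/seteqP; split=> // x _; exists (Num.bound `|d 0 x|) => //.
have [_] := KP (Num.bound `|d 0 x|); apply => /=.
apply: le_lt_trans (ler_norm _) _.
apply: lt_trans (archi_boundP (normr_ge0 _)) _.
by rewrite ltr_nat.
Qed.

(** * From normality to sigma-compactness *)

Lemma hls_normal_sigma_compact (lcG : locally_compact [set: G]) :
  hausdorff_space G -> hls_normal (group_hls lcG) -> sigma_compact G.
Proof.
move=> hausG normG; apply: contrapT => nsG.
(* [w C] is a point outside C; adding it to the chain makes H noncompact. *)
have /choice[w wP] : forall C, exists x, compact C -> ~ C x.
  move=> C; have [cC|] := pselect (compact C); last by exists 0.
  apply: contrapT => /forallNP CT; apply: nsG; exists (fun=> C); split=> //.
  apply/seteqP; split=> // x _; exists 0%N => //.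
  by apply: contrapT => nCx; exact: (CT x).
have [K [K0 cK wK Kle [nK KN KD]]] :=
  @compact_chain (fun _ C => [set w C]) lcG (fun _ _ _ => @compact_set1 _ _).
pose H := \bigcup_n K n.
have H0 : H 0 by exists 0%N; rewrite ?K0.
have HN x : H x -> H (- x) by move=> [n _ Kx]; exists n => //; exact: KN.
have HD x y : H x -> H y -> H (x + y).
  move=> [m _ Kx] [n _ Ky]; exists (maxn m n).+1 => //.
  by apply: KD; [apply: Kle Kx|apply: Kle Ky]; rewrite ?leq_maxl ?leq_maxr.
have nH0 : nbhs 0 H.
  have K1 : nbhs 0 (K 1%N) by apply: nK; rewrite K0.
  by apply: filterS K1 => x Kx; exists 1%N.
(* An open subgroup is closed. *)
have clH : closed H.
  move=> x /(closure_sub_nbhs0 nH0)[h [k [Hh /HN Hk ->]]]; exact: HD.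
(* A locally constant choice of coset representatives. *)
pose r x := xget 0 [set y | H (y - x)].
have rP x : H (r x - x).
  by apply: (@xgetPex _ 0 [set y | H (y - x)]); exists x; rewrite /= subrr.
have r_eq x y : H (x - y) -> r x = r y.
  move=> Hxy; congr (xget 0); apply/seteqP; split=> z /= Hz.
    by rewrite -(subrK x z) -addrA; exact: HD.
  by rewrite -(subrK y z) -addrA; apply: HD => //; rewrite -opprB; exact: HN.
have rD x k : H k -> r (x + k) = r x.
  by move=> Hk; apply: r_eq; rewrite addrAC subrr add0r.
have r_cont : continuous r.
  move=> x A Arx; apply/nbhs_addl; apply: filterS nH0 => k Hk /=.
  by rewrite rD //; exact: nbhs_singleton.
pose S := [set x | r x = x /\ ~ H x].
have clS : closed S.
  move=> x clSx; split.
    (* A point of [S] close to [x] lies in [x + H], so it equals [r x]; thus every neighbourhood of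
       [x] contains [r x]. *)
    apply: hausG => A B Ax Bx; exists (r x); split; first exact: nbhs_singleton.
    have [|y [[ry _] [By Hy]]] := clSx (B `&` [set y | H (y - x)]).
      apply: filterI => //; apply/nbhs_addl; apply: filterS nH0 => k /=.
      by rewrite addrAC subrr add0r.
    by rewrite -(r_eq _ _ Hy) ry.
  move=> Hx; have [|y [[_ nHy] Hy]] := clSx H; last exact: nHy.
  by apply/nbhs_addl; apply: filterS nH0 => k; exact: HD.
have hS : hybrid_neighbourhood (group_hls lcG) S (~` H).
  split.
    exists (~` H); first exact: closed_openC.
    by split=> //; move/closure_id: clS => <- x [].
  apply/coarse_neighbourhoodP; split=> [x []//|C cC].
  (* If [a + c] is in [H], then [a = r a = r (- c)], which stays in a compact set. *)
  exists [set p.1 + p.2 | p in (r @` [set - c | c in C]) `*` C].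
    apply: compact_add => //; apply: continuous_compact.
      exact: continuous_subspaceT.
    exact: compact_opp.
  move=> a c [ra _] Cc; have [Hac|] := pselect (H (a + c)); [right|by left].
  exists (a, c) => //; split=> //=; exists (- c); first by exists c.
  by rewrite -ra; apply/esym/r_eq; rewrite opprK.
have [V [_ [_ /coarse_neighbourhoodP[_ SV]] [_ /coarse_neighbourhoodP[_ VH]]]] :=
  normG S (~` H) clS hS.
have /choice[L LP] : forall n, exists D, compact D /\
    forall s k, S s -> K n k -> V (s + k) \/ D (s + k).
  by move=> n; have [D cD DP] := SV _ (cK n); exists D.
have [s sV] : exists s, forall h, H h -> V (s + h).
  (* Otherwise each [x] outside [H] has some [r x + h] outside [V], hence in some [L i], and differs
     from it by an element of some [K j]. The countably many compact sets [L i + K j] and [K j] then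
     cover [G]. *)
  apply: contrapT => /forallNP nV; apply: nsG.
  exists (fun n => if unpickle n is Some (i, j) then
    [set p.1 + p.2 | p in L i `*` K j] `|` K j else set0); split.
    move=> n; case: unpickle => [[i j]|]; last exact: compact0.
    by apply: compactU => //; apply: compact_add => //; have [] := LP i.
  apply/seteqP; split=> // x _; have [[j _ Kx]|nHx] := pselect (H x).
    by exists (pickle (0%N, j)) => //; rewrite pickleK; right.
  have Srx : S (r x).
    split; first exact/r_eq.
    by move=> Hrx; apply: nHx; rewrite -(subKr (r x) x); apply/HD/HN.
  have [h /not_implyP[[i _ Kh] nVh]] : exists h, ~ (H h -> V (r x + h)).
    exact/existsNP/nV.
  have [j _ Kj] : H (x - (r x + h)).
    have -> : x - (r x + h) = - (r x - x + h).
      by rewrite !opprD opprK addrA [x - _]addrC.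
    by apply/HN/HD; [exact: rP|exists i].
  exists (pickle (i, j)) => //; rewrite pickleK; left.
  exists (r x + h, x - (r x + h)); last by rewrite /= addrC subrK.
  by split=> //=; have [_ /(_ _ _ Srx Kh)[]] := LP i.
have [|D cD VD] := VH [set - s]; first exact: compact_set1.
have HD' : H `<=` D.
  move=> h Hh; have [] := VD _ (- s) (sV _ Hh) erefl.
    by rewrite addrAC subrr add0r.
  by rewrite addrAC subrr add0r.
have cH : compact H by rewrite -(setIidr HD'); exact: compact_closedI.
(* No [K n] contains [H], because [w (K n)] lies in [K n.+1]. *)
have [//|n Hn] := compact_sub_bigcup cH Kle nK.
by apply: (wP (K n)) => //; apply: Hn; exists n.+1 => //; exact: wK.
Qed.

(** * From sigma-compactness to normality *)

Lemma nbhs0_sub U : nbhs 0 U ->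
  exists2 P, nbhs 0 P & forall p q, P p -> P q -> U (p - q).
Proof.
move=> U0; have := @sub_continuous G (0, 0) U.
rewrite /= subr0 => /(_ U0)[[A B] /= [A0 B0] ABU].
exists (A `&` B); first exact: filterI.
by move=> p q [Ap _] [_ Bq]; exact: (ABU (p, q)).
Qed.

(** The tube lemma for addition around [A] times [0]. *)
Lemma compact_add_sub_open A O : compact A -> open O -> A `<=` O ->
  exists2 U, nbhs 0 U & forall a u, A a -> U u -> O (a + u).
Proof.
move=> /compact_near_coveringP cA oO AO.
have U0 : \forall u \near (0 : G), A `<=` (fun a => O (a + u)).
  apply: cA => x Ax; have := @add_continuous G (x, 0) O; rewrite /= addr0; apply.
  exact/open_nbhs_nbhs/(conj oO)/AO.
by exists [set u | A `<=` (fun a => O (a + u))] => // a u Aa /(_ a Aa).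
Qed.

Lemma sigma_compact_hls_normal (lcG : locally_compact [set: G]) :
  hausdorff_space G -> sigma_compact G -> hls_normal (group_hls lcG).
Proof.
move=> hausG /(length_function lcG)[l [_ lN lD l1 [lc lb]]].
move=> A N clA [[W oW [clAW WN]] /coarse_neighbourhoodP[AN AC]].
have /choice[f fP] : forall n, exists m, forall a k, A a -> (l k <= n)%N ->
    N (a + k) \/ (l (a + k)%R <= m)%N.
  move=> n; have [D cD AD] := AC _ (lc n); have [m Dm] := lb D cD.
  by exists m => a k Aa lk; have [|/Dm] := AD a k Aa lk; [left|right].
(* Chosen so that moving a point of V0 with witness n by a k with l k <= n + 2
   cannot leave N: see V0N. *)
pose g n := (f (n.*2.+2) + n.+2)%N.
pose V0 := [set x | exists a n, [/\ A a, (l (x - a)%R <= n)%N & (g n < l x)%N]].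
have lB x y : (l (x - y)%R <= l x + l y)%N by rewrite -(lN y).
have lK x k : (l x <= l (x + k)%R + l k)%N.
  by rewrite -{1}(addrK k x); exact: lB.
have V0N a n x k : A a -> (l (x - a)%R <= n)%N -> (g n < l x)%N ->
    (l k <= n.+2)%N -> N (x + k).
  move=> Aa lxa gx lk; have xkE : x + k = a + (x - a + k).
    by rewrite addrA [a + _]addrC subrK.
  have [||] := fP n.*2.+2 a (x - a + k) Aa; rewrite -?xkE//.
    by apply: leq_trans (lD _ _) _; lia.
  by move=> lf; have := lK x k; rewrite /g in gx; lia.
(* For [a] in [A] beyond this threshold and [l p <= 1], [a + p] is longer than [g 1], hence in [V0]
   with witness [1]; only [A1] needs thickening. *)
pose A1 := A `&` [set x | (l x <= (g 1%N).+1)%N].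
have cA1 : compact A1 by rewrite /A1 setIC; exact: compact_closedI.
have AW : A `<=` W by move=> a Aa; apply/clAW/subset_closure.
have [U U0 AU] : exists2 U, nbhs 0 U & forall a u, A1 a -> U u -> W (a + u).
  by apply: compact_add_sub_open => // a [/AW].
(* [P - P + P] must fit in [U]: one term thickens [A1], one reaches the closure, one gives room
   around a closure point. *)
have [Q Q0 QU] := nbhs0_sub U0.
have [P' P'0 PQ] := nbhs0_sub Q0.
pose P := P' `&` [set x | (l x <= 1)%N].
have P0 : nbhs 0 P by exact: filterI.
have PU p q r : P p -> P q -> P r -> U (p - q + r).
  move=> [Pp _] [Pq _] [Pr _]; rewrite -[r]opprK -[- r]add0r.
  by apply: QU; apply: PQ => //; exact: nbhs_singleton.
pose V' := V0 `|` [set p.1 + p.2 | p in A1 `*` P].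
have V'N v p q : V' v -> P p -> P q -> N (v - p + q).
  case=> [[a [n [Aa lva gv]]]|[[a u] [/= A1a Pu] <-]] Pp Pq.
    rewrite -addrA; apply: (V0N a n) => //.
    have [[_ /= lp] [_ /= lq]] := (Pp, Pq).
    by apply: leq_trans (lD _ _) _; rewrite lN; lia.
  by apply/WN; rewrite -!addrA; apply: AU => //; rewrite addrA; exact: PU.
have AV' a p : A a -> P p -> V' (a + p).
  move=> Aa Pp; have [la|la] := leqP (l a) (g 1%N).+1.
    by right; exists (a, p).
  left; exists a, 1%N; have [_ /= lp] := Pp.
  split=> //; first by rewrite addrAC subrr add0r.
  by have := lK a p; lia.
exists (closure V'); split; first exact: closed_closure.
  split.
    exists (interior (closure V')); first exact: open_interior.
    split; last exact: interior_subset.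
    move/closure_id: clA => <- a Aa; apply/nbhs_addl.
    by apply: filterS P0 => p Pp; apply: subset_closure; exact: AV'.
  apply/coarse_neighbourhoodP; split=> [a Aa|C /lb[m Cm]].
    rewrite -[a]addr0; apply: subset_closure; apply: AV' => //.
    exact: nbhs_singleton.
  exists [set x | (l x <= g m)%N] => // a c Aa Cc.
  have [|gac] := leqP (l (a + c)) (g m); [by right|left].
  apply: subset_closure; left; exists a, m; split=> //.
  by rewrite addrAC subrr add0r; exact: Cm.
split.
  exists (interior N); first exact: open_interior.
  split; last exact: interior_subset.
  have /closure_id <- := @closed_closure _ V'.
  move=> _ /(closure_sub_nbhs0 P0)[v [p [V'v Pp ->]]]; apply/nbhs_addl.
  by apply: filterS P0 => q; exact: V'N.
apply/coarse_neighbourhoodP; split=> [_ /(closure_sub_nbhs0 P0)[v [p [V'v Pp ->]]]|].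
  by rewrite -[_ - _]addr0; apply: V'N => //; exact: nbhs_singleton.
move=> C /lb[m Cm].
(* The [f] term serves points of [V0] with small witness n, where n + m + 1 <= 2(m + 1); the other
   two bound the thickened [A1] and the move [- p + c]. *)
exists [set x | (l x <= f (m.+1).*2 + (g 1%N).+2 + m.+1)%N] => //.
move=> _ c /(closure_sub_nbhs0 P0)[v [p [V'v [_ /= lp] ->]]] /Cm /= lcm.
have lk : (l (- p + c)%R <= m.+1)%N by apply: leq_trans (lD _ _) _; rewrite lN; lia.
rewrite -addrA; case: V'v => [[a [n [Aa lva gv]]]|[[a u] [/= [_ /= la] [_ /= lu]] <-]].
  have [mn|nm] := leqP m.+1 n.+2.
    by left; apply: (V0N a n) => //; exact: leq_trans lk mn.
  have vkE : v + (- p + c) = a + (v - a + (- p + c)).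
    by rewrite [RHS]addrA [a + _]addrC subrK.
  have [||] := fP (m.+1).*2 a (v - a + (- p + c)) Aa; rewrite -?vkE.
  - by apply: leq_trans (leq_trans (lD _ _) (leq_add lva lk)) _; lia.
  - by left.
  - by move=> lf; right; apply: leq_trans lf _; rewrite -addnA leq_addr.
right; apply: leq_trans (lD _ _) _.
by apply: leq_trans (leq_add (leq_trans (lD _ _) (leq_add la lu)) lk) _; lia.
Qed.

End topological_group.

Theorem theorem11p3 (R : realType) (G : topologicalZmodType)
    (hausG : hausdorff_space G) (lcG : locally_compact [set: G]) :
  (hls_normal (group_hls lcG) <-> sigma_compact G) /\
  (sigma_compact G <-> ls_metrizable R (group_hls lcG)).
Proof.
split; split.
- exact: hls_normal_sigma_compact.
- exact: sigma_compact_hls_normal.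
- exact: sigma_compact_ls_metrizable.
- exact: ls_metrizable_sigma_compact.
Qed.
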